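(* Let $m\ge 2$ and $n\ge 0$ be integers, let $N\ge m+n$, let $a_{-n},\dots,a_{m-1}\in\mathbb{C}$ with $a_{m-1}\neq 0$ and $a_{-n}\neq 0$, and let $A=\mathsf{circ}(a_0,\dots,a_{m-1},0,\dots,0,a_{-n},\dots,a_{-1})\in\mathbb{C}^{N\times N}$. Put $$g(z)=\sum_{k=-n}^{m-1}a_k z^{k+n},\qquad h(z)=\sum_{k=-n}^{m-1}a_k z^{m-k-1}.$$ Assume that $g$ has no roots on the unit circle $U=\{z\in\mathbb{C}:|z|=1\}$. Let $z_1,\dots,z_s$ be the distinct roots of $g$ located inside $U$ (i.e. with $|z|<1$) and $p_1,\dots,p_s$ their respective orders (multiplicities); let $w_1,\dots,w_t$ be the distinct roots of $h$ located inside $U$ and $q_1,\dots,q_t$ their respective orders. Then $A$ is invertible and its inverse is the circulant matrix $B\in\mathbb{C}^{N\times N}$ with elements $B_{j,\ell}=b_{(j-\ell)\bmod N}$, where for $j=0,\dots,N-1$ $$b_j=\sum_{k=1}^s\sum_{p'=0}^{p_k-1}c_{g,k,p'}\,(-j+n-1+N)^{\underline{p'}}\,z_k^{-j+n-1+N-p'}+\sum_{k=1}^t\sum_{q'=0}^{q_k-1}c_{h,k,q'}\,(j+m-2)^{\underline{q'}}\,w_k^{j+m-2-q'},$$ with $$c_{g,k,p'}=\sum_{p=p'}^{p_k-1}\frac{1}{(p_k-1)!}\binom{p_k-1}{p}\binom{p}{p'}\left(\frac{1}{g_k(z)}\right)^{(p_k-1-p)}\Big|_{z=z_k}\left(\frac{1}{1-z^N}\right)^{(p-p')}\Big|_{z=z_k},\qquad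 g_k(z)=\frac{g(z)}{(z-z_k)^{p_k}},$$ $$c_{h,k,q'}=\sum_{q=q'}^{q_k-1}\frac{1}{(q_k-1)!}\binom{q_k-1}{q}\binom{q}{q'}\left(\frac{1}{h_k(z)}\right)^{(q_k-1-q)}\Big|_{z=w_k}\left(\frac{1}{1-z^N}\right)^{(q-q')}\Big|_{z=w_k},\qquad h_k(z)=\frac{h(z)}{(z-w_k)^{q_k}}.$$
   Context: Rows and columns of $N\times N$ matrices are indexed by $0,\dots,N-1$. For $c_0,\dots,c_{N-1}\in\mathbb{C}$, $\mathsf{circ}(c_0,\dots,c_{N-1})$ is the circulant matrix with entries $c_{(i-j)\bmod N}$ (its first column is $(c_0,\dots,c_{N-1})^\top$). Thus in $\mathsf{circ}(a_0,\dots,a_{m-1},0,\dots,0,a_{-n},\dots,a_{-1})$ we have $c_k=a_k$ for $0\le k\le m-1$, $c_{N+k}=a_k$ for $-n\le k\le -1$, and $c_k=0$ for all other indices. The notation $(f(z))^{(p)}|_{z=w}$ denotes the $p$-th derivative of $f$ at $w$. $M^{\underline{r}}$ is the falling factorial: $M^{\underline{0}}=1$ and $M^{\underline{r}}=M(M-1)\cdots(M-r+1)$ for $r\ge1$. The quotients $g_k$, $h_k$ are polynomials (after cancellation). Empty sums are zero. *)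

(* Defs.v *)
From mathcomp Require Import all_boot all_order all_algebra.
From mathcomp Require Import complex.
From mathcomp Require Import all_classical all_reals all_analysis.
Import GRing.Theory Num.Theory.
Import numFieldNormedType.Exports.

Set Implicit Arguments.
Unset Strict Implicit.
Unset Printing Implicit Defensive.

Local Open Scope ring_scope.

Section CirculantInverse.
Variable R : realType.
Local Notation C := R[i].

Definition circulant (N : nat) (c : nat -> C) : 'M[C]_N :=
  \matrix_(i < N, j < N) c ((i + N - j) %% N)%N.

(* The sequence (a_0, ..., a_{m-1}, 0, ..., 0, a_{-n}, ..., a_{-1}) of length
   N >= m + n; the family a is indexed by int, and only its values on
   [-n, m-1] matter. *)
Definition banded_col (a : int -> C) (m n N k : nat) : C :=
  if (k < m)%N then a k%:Z
  else if (N - n <= k)%N then a (k%:Z - N%:Z)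
  else 0.

(* Both sums run over k = i - n for 0 <= i < m + n. *)
Definition gpoly (a : int -> C) (m n : nat) : {poly C} :=
  \sum_(i < m + n) a (i%:Z - n%:Z) *: 'X^i.

Definition hpoly (a : int -> C) (m n : nat) : {poly C} :=
  \sum_(i < m + n) a (i%:Z - n%:Z) *: 'X^(m + n - 1 - i).

Definition deflate (f : {poly C}) (w : C) (r : nat) : {poly C} :=
  f %/ ('X - w%:P) ^+ r.

(* The n-th derivatives derive1n are complex (limits of difference quotients
   over C). This is c_{g,k,p'} for (f, w, r) = (g, z_k, p_k) and c_{h,k,p'} for
   (f, w, r) = (h, w_k, q_k). *)
Definition ccoef (N : nat) (f : {poly C}) (w : C) (r p' : nat) : C :=
  \sum_(p' <= p < r)
     ((r - 1)`!)%:R^-1 * 'C(r - 1, p)%:R * 'C(p, p')%:R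
     * derive1n (r - 1 - p) (fun x : C => ((deflate f w r).[x])^-1 : C^o) w
     * derive1n (p - p') (fun x : C => (1 - x ^+ N)^-1 : C^o) w.

(* For j < N and m >= 2, the natural subtractions N + n - 1 - j and j + m - 2
   are not truncated. The exponents of z k and w k are integers: they can be
   negative, but only when the falling factorial vanishes. *)
Definition bcoef (m n N : nat) (g h : {poly C})
    (s : nat) (z : 'I_s -> C) (p : 'I_s -> nat)
    (t : nat) (w : 'I_t -> C) (q : 'I_t -> nat) (j : nat) : C :=
  \sum_(k < s) \sum_(p' < p k)
     ccoef N g (z k) (p k) p' * ((N + n - 1 - j) ^_ p')%:R
     * z k ^ ((N + n - 1 - j)%N%:Z - p'%:Z)
  + \sum_(k < t) \sum_(q' < q k)
     ccoef N h (w k) (q k) q' * ((j + m - 2) ^_ q')%:R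
     * w k ^ ((j + m - 2)%N%:Z - q'%:Z).

End CirculantInverse.

(* Main.v *)
(* With D = 1 - X^N, let rho(P) be the sum of the residues of P/g over all the
   roots of g, that is, minus the residue at infinity. By the Leibniz rule, the
   inner sums defining b_j are the residues of z^(N+n-1-j) / (g D) at z_k and of
   z^(j+m-2) / (h D) at w_k. The substitution z -> 1/z turns the latter into
   residues of z^(N+n-1-j) / (g D) at the roots of g outside the unit circle, so
   that b_j = rho(X^(N+n-1-j) E) with E an inverse of D modulo g. In the
   convolution of (a_k) with (b_j), an index that wraps around modulo N changes
   the exponent by N, hence changes rho(. E) by rho(. D E) = rho(.), evaluated at
   a power of X of degree at most m + n - 2. This vanishes except in degree
   m + n - 2, where it is 1 / a_(m-1): this is the diagonal of A B. Without
   wrapping, the sum is rho of a multiple of g, which is zero. *)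
Require Import Defs.
From mathcomp Require Import all_boot all_order all_algebra.
From mathcomp Require Import complex.
From mathcomp Require Import all_classical all_reals all_analysis.
From mathcomp Require Import ring zify.
Import Order.TTheory GRing.Theory Num.Theory.
Import numFieldNormedType.Exports.

Set Implicit Arguments.
Unset Strict Implicit.
Unset Printing Implicit Defensive.

Local Open Scope ring_scope.

(** * Sums of residues *)

Lemma coefM_top (R : nzRingType) (p q : {poly R}) (a b : nat) :
  (size p <= a.+1)%N -> (size q <= b.+1)%N -> (p * q)`_(a + b) = p`_a * q`_b.
Proof.
move=> sp sq; rewrite coefM.
have lt_a : (a < (a + b).+1)%N by rewrite ltnS leq_addr.
rewrite (bigD1 (Ordinal lt_a)) //= addKn big1 ?addr0 // => i neq_ia.
have {}neq_ia : (i : nat) != a by apply: contraNneq neq_ia => eq_ia; apply/eqP/val_inj.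
case: (ltngtP i a) neq_ia => // [lt_ia|lt_ai] _.
  by rewrite [q`_ _]nth_default ?mulr0 // (leq_trans sq) // ltn_subRL ltn_add2r.
by rewrite nth_default ?mul0r // (leq_trans sp).
Qed.

Lemma modp_mul2r (F : fieldType) (p d e : {poly F}) :
  e != 0 -> (p * e) %% (d * e) = (p %% d) * e.
Proof.
move=> e0; have [->|d0] := eqVneq d 0; first by rewrite mul0r !modp0.
rewrite {1}(divp_eq p d) mulrDl -mulrA modp_addl_mul_small //.
have [->|r0] := eqVneq (p %% d) 0.
  by rewrite mul0r size_poly0 size_poly_gt0 mulf_neq0.
rewrite !size_mul // -!subn1 ltn_sub2r //; last by rewrite ltn_add2r ltn_modp.
by rewrite (@leq_trans (1 + 1)) // leq_add ?size_poly_gt0.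
Qed.

(* The sum of the residues of P / g over all the roots of g, i.e. minus its
   residue at infinity. When g is constant the index is truncated to 0, but then
   P %% g = 0 and the sum is 0, as it should be. *)
Definition residue_sum (F : fieldType) (g P : {poly F}) : F :=
  (P %% g)`_(size g).-2 / lead_coef g.

Lemma residue_sum_small (F : fieldType) (g P : {poly F}) :
  (size P < size g)%N -> residue_sum g P = P`_(size g).-2 / lead_coef g.
Proof. by move=> h; rewrite /residue_sum modp_small. Qed.

Lemma residue_sumD (F : fieldType) (g P Q : {poly F}) :
  residue_sum g (P + Q) = residue_sum g P + residue_sum g Q.
Proof. by rewrite /residue_sum modpD coefD mulrDl. Qed.

Lemma residue_sumZ (F : fieldType) (g P : {poly F}) (a : F) :
  residue_sum g (a *: P) = a * residue_sum g P.
Proof. by rewrite /residue_sum modpZl coefZ mulrA. Qed.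

Lemma residue_sum_sum (F : fieldType) (g : {poly F}) (I : Type) (r : seq I)
    (P : I -> {poly F}) :
  residue_sum g (\sum_(i <- r) P i) = \sum_(i <- r) residue_sum g (P i).
Proof.
apply: (big_morph _ (residue_sumD g)).
by rewrite /residue_sum mod0p coef0 mul0r.
Qed.

Lemma residue_sum_congr (F : fieldType) (g P Q : {poly F}) :
  g %| P - Q -> residue_sum g P = residue_sum g Q.
Proof.
move=> /modp_eq0P gPQ; rewrite /residue_sum; congr (_`_ _ / _).
by rewrite -[P](subrK Q) modpD gPQ add0r.
Qed.

(** Both sides refer to the same fraction. In coefficients, the remainder gets multiplied by [e],
    and hence its coefficient of top degree by [lead_coef e]. *)
Lemma residue_sum_mul2r (F : fieldType) (g e P : {poly F}) :
  g != 0 -> e != 0 -> residue_sum (g * e) (P * e) = residue_sum g P.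
Proof.
move=> g0 e0; rewrite /residue_sum modp_mul2r // lead_coefM size_mul //.
have sr : (size (P %% g)%R < size g)%N by rewrite ltn_modp.
case sg : (size g) sr => [|[|a]] /=; first by [].
  by rewrite ltnS leqn0 size_poly_eq0 => /eqP ->; rewrite mul0r !coef0 !mul0r.
case se : (size e) => [|b]; first by move/eqP: se; rewrite size_poly_eq0 (negPf e0).
rewrite ltnS addnS /= => sr; rewrite coefM_top ?se //.
have -> : e`_b = lead_coef e by rewrite lead_coefE se.
by rewrite -mulf_div divff ?mulr1 // lead_coef_eq0.
Qed.

Lemma residue_sumZl (F : fieldType) (g P : {poly F}) (c : F) :
  c != 0 -> residue_sum (c *: g) (c *: P) = residue_sum g P.
Proof.
move=> c0; have [->|g0] := eqVneq g 0.
  by rewrite scaler0 /residue_sum !lead_coef0 invr0 !mulr0.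
rewrite -2!mul_polyC ![c%:P * _]mulrC residue_sum_mul2r //.
by rewrite polyC_eq0.
Qed.

Lemma coef_comp_XaddC (F : numFieldType) (P : {poly F}) (w : F) (i : nat) :
  (P \Po ('X + w%:P))`_i *+ i`! = P^`(i).[w].
Proof.
transitivity ((P \Po ('X + w%:P))^`(i)).[0].
  by rewrite horner_coef0 coef_derivn addn0 ffactnn.
have -> : (P \Po ('X + w%:P))^`(i) = P^`(i) \Po ('X + w%:P).
  elim: i => [|i IH]; first by rewrite !derivn0.
  by rewrite !derivnS IH deriv_comp derivD derivX derivC addr0 mulr1.
by rewrite horner_comp !hornerE.
Qed.

Lemma coef_comp_XaddC_top (F : numFieldType) (P : {poly F}) (w : F) (r : nat) :
  (size P <= r.+1)%N -> (P \Po ('X + w%:P))`_r = P`_r.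
Proof.
move=> sP; have f0 : (r`!)%:R != 0 :> F by rewrite pnatr_eq0 -lt0n fact_gt0.
apply: (mulIf f0); rewrite !mulr_natr coef_comp_XaddC.
rewrite (@size1_polyC _ P^`(r)) ?hornerC ?coef_derivn ?addn0 ?ffactnn //.
apply/leq_sizeP => -[|j] // _; rewrite coef_derivn nth_default ?mul0rn //.
by rewrite addnS (leq_trans sP) // ltnS leq_addr.
Qed.

Lemma comp_XsubC_XaddC (R : comNzRingType) (w : R) :
  ('X - w%:P) \Po ('X + w%:P) = 'X.
Proof. by rewrite comp_polyB comp_polyX comp_polyC addrK. Qed.

(** After translating [w] to 0, the multiple of the divisor only contributes in degrees above [r],
    and the remainder, of degree at most [r], keeps its coefficient of degree [r]. This is the
    residue at a pole as a Taylor coefficient. *)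
Lemma residue_sum_XsubC_exp (F : numFieldType) (w : F) (r : nat) (P : {poly F}) :
  residue_sum (('X - w%:P) ^+ r.+1) P = (P \Po ('X + w%:P))`_r.
Proof.
have mon : ('X - w%:P) ^+ r.+1 \is monic by rewrite monic_exp ?monicXsubC.
rewrite /residue_sum (monicP mon) divr1 size_exp_XsubC /=.
rewrite {2}(divp_eq P (('X - w%:P) ^+ r.+1)) comp_polyD coefD comp_polyM.
rewrite rmorphXn /= comp_XsubC_XaddC coefMXn ltnSn add0r coef_comp_XaddC_top //.
have := ltn_modpN0 P (monic_neq0 mon).
by rewrite size_exp_XsubC ltnS.
Qed.

(** * Coprime factors and partial fractions *)

Lemma coprimep_XsubC_exp (F : fieldType) (x y : F) (k l : nat) :
  x != y -> coprimep (('X - x%:P) ^+ k) (('X - y%:P) ^+ l).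
Proof.
move=> xy; rewrite coprimep_expl ?coprimep_expr // coprimep_XsubC root_XsubC.
by rewrite eq_sym.
Qed.

Lemma coprimep_inverse (F : fieldType) (p q : {poly F}) :
  coprimep p q -> exists u, p %| 1 - u * q.
Proof.
move=> /Bezout_eq1_coprimepP [[u v] /= uv].
by exists v; rewrite -uv addrK dvdp_mulIr.
Qed.

Lemma prod_dvdp_coprime (F : fieldType) (I : eqType) (r : seq I)
    (Y : I -> {poly F}) (Q : {poly F}) :
  uniq r -> (forall i j, i != j -> coprimep (Y i) (Y j)) ->
  (forall i, Y i %| Q) -> \prod_(i <- r) Y i %| Q.
Proof.
move=> + cY dY; elim: r => [|i r IH] /=; first by rewrite big_nil dvd1p.
case/andP => ir /IH dr; rewrite big_cons Gauss_dvdp ?dY //.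
elim: r ir {dr IH} => [|j r IH]; first by rewrite big_nil coprimep1.
rewrite inE negb_or => /andP[ij /IH cr].
by rewrite big_cons coprimepMr cY.
Qed.

Lemma coprimep_prodr (F : fieldType) (I : finType) (P : pred I)
    (Y : I -> {poly F}) (Q : {poly F}) :
  (forall i, P i -> coprimep Q (Y i)) -> coprimep Q (\prod_(i | P i) Y i).
Proof.
move=> cQ; elim/big_ind: _ => [|p q cp cq|//]; first by rewrite coprimep1.
by rewrite coprimepMr cp.
Qed.

(* With [e i] inverse to the cofactor [L i] of [Y i] modulo [Y i], the sum of the
   [e i * L i] is 1 modulo the whole product: this is the partial fraction
   decomposition. *)
Lemma residue_sum_prod (F : fieldType) (I : finType) (Y : I -> {poly F})
    (P : {poly F}) :
  (forall i, Y i != 0) -> (forall i j, i != j -> coprimep (Y i) (Y j)) ->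
  exists2 e : I -> {poly F},
    forall i, Y i %| 1 - e i * \prod_(j | j != i) Y j &
    residue_sum (\prod_i Y i) P = \sum_i residue_sum (Y i) (P * e i).
Proof.
move=> Y0 cY; pose L i := \prod_(j | j != i) Y j.
have YL i : \prod_j Y j = Y i * L i by rewrite (bigD1 i).
have /fin_all_exists[e he] i : exists u, Y i %| 1 - u * L i.
  by apply/coprimep_inverse/coprimep_prodr => j ji; rewrite cY // eq_sym.
exists e => //.
have -> : residue_sum (\prod_i Y i) P =
    residue_sum (\prod_i Y i) (\sum_i (P * e i) * L i).
  apply: residue_sum_congr; under [X in _ - X]eq_bigr do rewrite -mulrA.
  rewrite -mulr_sumr -{1}[P]mulr1 -mulrBr dvdp_mull //.
  apply: prod_dvdp_coprime => [|//|i]; first exact: index_enum_uniq.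
  rewrite (bigD1 i) //= opprD addrA dvdp_sub ?he //.
  elim/big_ind: _ => [|p q|j ji]; first exact: dvdp0.
    exact: dvdp_add.
  by rewrite dvdp_mull // /L (bigD1 i) ?dvdp_mulIl // eq_sym.
rewrite residue_sum_sum; apply: eq_bigr => i _.
by rewrite (YL i) residue_sum_mul2r //; apply/prodf_neq0 => j _.
Qed.

(** Used to split off the roots of [g] and [h] inside the unit circle. If the cofactor vanished at
    [z k], the multiplicity of [z k] would exceed [p k]. *)
Lemma prod_XsubC_exp_mup (F : fieldType) (s : nat) (z : 'I_s -> F)
    (p : 'I_s -> nat) (f : {poly F}) :
  f != 0 -> injective z -> (forall k, p k = mup (z k) f) ->
  exists2 f2, f = \prod_k ('X - (z k)%:P) ^+ p k * f2 &
    forall k, f2.[z k] != 0.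
Proof.
move=> f0 z_inj pE; have /dvdpP[f2 ef] : \prod_k ('X - (z k)%:P) ^+ p k %| f.
  apply: prod_dvdp_coprime => [|i j ij|i]; first exact: index_enum_uniq.
    by rewrite coprimep_XsubC_exp // (inj_eq z_inj).
  by rewrite -mup_geq // pE.
exists f2 => [|k]; first by rewrite mulrC.
apply/negP => /eqP/rootP; rewrite -dvdp_XsubCl => /dvdpP[f3 ef3].
have : (p k < mup (z k) f)%N; last by rewrite pE ltnn.
rewrite mup_geq // ef (bigD1 k) //= ef3 mulrA dvdp_mulr // exprS.
by rewrite -mulrA dvdp_mulIr.
Qed.

Lemma root_prod_XsubC_exp (F : idomainType) (Q : F -> Prop) (I : finType)
    (z : I -> F) (p : I -> nat) (x : F) :
  (forall k, Q (z k)) -> root (\prod_k ('X - (z k)%:P) ^+ p k) x -> Q x.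
Proof.
move=> Qz; elim/big_ind: _ => [|P1 P2 IH1 IH2|k _].
- by rewrite /root hornerC oner_eq0.
- by rewrite rootM => /orP[/IH1|/IH2].
- case: (p k) => [|r]; first by rewrite expr0 /root hornerC oner_eq0.
  by rewrite root_exp_XsubC => /eqP ->.
Qed.

(** * Reversal of polynomials *)

(** A nonzero difference would have as many roots 1, 2, 3, ... as its size. Identities between
    reversals can thus be checked where X^k P(1/X) makes sense. *)
Lemma poly_eq_neq0 (F : numFieldType) (p q : {poly F}) :
  (forall x, x != 0 -> p.[x] = q.[x]) -> p = q.
Proof.
move=> epq; apply/eqP; rewrite -subr_eq0; apply/negPn/negP => pq0.
pose rs : seq F := [seq i.+1%:R | i <- iota 0 (size (p - q))].
have /(max_poly_roots pq0) : all (root (p - q)) rs.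
  apply/allP => _ /mapP[i _ ->].
  by rewrite /root !hornerE epq ?subrr ?pnatr_eq0.
have uniq_rs : uniq rs.
  rewrite map_inj_uniq ?iota_uniq // => i j /eqP.
  by rewrite eqr_nat eqSS => /eqP.
by move/(_ uniq_rs); rewrite size_map size_iota ltnn.
Qed.

(* Indexed by a bound k on the degree, so that X^k P(1/X) stays defined when
   the degree of P is smaller. *)
Definition revp (R : nzRingType) (k : nat) (P : {poly R}) : {poly R} :=
  \poly_(i < k.+1) P`_(k - i).

Lemma coef_revp (R : nzRingType) (k : nat) (P : {poly R}) (i : nat) :
  (i <= k)%N -> (revp k P)`_i = P`_(k - i).
Proof. by move=> ik; rewrite coef_poly ltnS ik. Qed.

Lemma size_revp (R : nzRingType) (k : nat) (P : {poly R}) :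
  (size (revp k P) <= k.+1)%N.
Proof. exact: size_poly. Qed.

Lemma horner_revp (F : fieldType) (k : nat) (P : {poly F}) (x : F) :
  (size P <= k.+1)%N -> x != 0 -> (revp k P).[x] = x ^+ k * P.[x^-1].
Proof.
move=> sP x0; rewrite horner_poly (horner_coef_wide _ sP) mulr_sumr.
rewrite (reindex_inj rev_ord_inj) /=; apply: eq_bigr => i _.
rewrite subSS subKn; last by rewrite -ltnS.
rewrite mulrCA; congr (_ * _); rewrite expfB_cond ?exprVn //.
by rewrite (negPf x0) leq_ord.
Qed.

Lemma revpK (R : nzRingType) (k : nat) (P : {poly R}) :
  (size P <= k.+1)%N -> revp k (revp k P) = P.
Proof.
move=> sP; apply/polyP => i; rewrite coef_poly ltnS.
case: leqP => ik; last by rewrite nth_default // (leq_trans sP).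
by rewrite coef_revp ?leq_subr // subKn.
Qed.

Lemma revpD (R : nzRingType) (k : nat) (P Q : {poly R}) :
  revp k (P + Q) = revp k P + revp k Q.
Proof.
by apply/polyP => i; rewrite coefD !coef_poly; case: ifP; rewrite ?coefD ?addr0.
Qed.

Lemma size_polyM_leq (R : nzRingType) (p q : {poly R}) (k l : nat) :
  (size p <= k)%N -> (size q <= l.+1)%N -> (size (p * q)%R <= k + l)%N.
Proof.
move=> sp sq; rewrite (leq_trans (size_polyMleq _ _)) // -subn1 leq_subLR.
by rewrite add1n -addnS leq_add.
Qed.

Lemma size_factor_leq (R : idomainType) (p q : {poly R}) (k d : nat) :
  size q = d.+1 -> (size (p * q)%R <= k + d)%N -> (size p <= k)%N.
Proof.
move=> sq; have [->|p0] := eqVneq p 0; first by rewrite size_poly0.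
by rewrite size_mul // -?size_poly_gt0 sq // addnS leq_add2r.
Qed.

Lemma revpM (F : numFieldType) (k l : nat) (P Q : {poly F}) :
  (size P <= k.+1)%N -> (size Q <= l.+1)%N ->
  revp (k + l) (P * Q) = revp k P * revp l Q.
Proof.
move=> sP sQ; apply: poly_eq_neq0 => x x0.
rewrite hornerM !horner_revp // ?hornerM ?exprD 1?mulrACA //.
by rewrite -addSn size_polyM_leq.
Qed.

Lemma revpZ (R : nzRingType) (k : nat) (c : R) (P : {poly R}) :
  revp k (c *: P) = c *: revp k P.
Proof.
by apply/polyP => i; rewrite coefZ !coef_poly; case: ifP; rewrite ?coefZ ?mulr0.
Qed.

Lemma revp_sum (K : nzRingType) (k : nat) (I : Type) (r : seq I)
    (P : I -> {poly K}) :
  revp k (\sum_(i <- r) P i) = \sum_(i <- r) revp k (P i).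
Proof.
apply: (big_morph _ (revpD k)).
by apply/polyP => i; rewrite coef_poly !coef0 if_same.
Qed.

Lemma revpXn (R : nzRingType) (k M : nat) :
  (M <= k)%N -> revp k 'X^M = 'X^(k - M) :> {poly R}.
Proof.
move=> Mk; apply/polyP => i; rewrite coef_poly !coefXn ltnS.
case: leqP => ik; last by case: eqP => // ei; move: ik; rewrite ei; lia.
by congr (_%:R); congr nat_of_bool; apply/eqP/eqP; lia.
Qed.

Lemma revp_1subXn (R : nzRingType) (N : nat) :
  revp N (1 - 'X^N) = - (1 - 'X^N) :> {poly R}.
Proof.
apply/polyP => i; rewrite coef_poly coefN !coefB !coefXn !coef1 ltnS opprB.
case: leqP => iN; last by rewrite !gtn_eqF ?subrr // (leq_trans _ iN).
congr (_%:R - _%:R); congr nat_of_bool; apply/eqP/eqP; lia.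
Qed.

Lemma size_1subXn (R : nzRingType) (N : nat) :
  (size (1 - 'X^N : {poly R})%R <= N.+1)%N.
Proof.
rewrite (leq_trans (size_polyD _ _)) // geq_max size_poly1 ltn0Sn /=.
by rewrite size_polyN size_polyXn.
Qed.

(* Substitution z -> 1/z: the residues of z^M / (p1 p2 D) at the roots of p2 are
   those of z^M' / (p1' p2' D) at the roots of p2', where p1', p2' are the
   reversals; the sign in dz = - du / u^2 cancels the one in revp N D = - D. The
   partial fraction decomposition of 'X^M over p1, p2 and D is reversed term by
   term. *)
Lemma residue_sum_reverse (F : numFieldType) (p1 p2 E U1 U2 : {poly F})
    (d1 d2 N M M' : nat) :
  let D := 1 - 'X^N in
  size p1 = d1.+1 -> size p2 = d2.+1 -> p2.[0] != 0 ->
  p1 * p2 %| 1 - E * D ->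
  p1 %| 1 - U1 * (p2 * D) ->
  revp d2 p2 %| 1 - U2 * (revp d1 p1 * D) ->
  (M + M' + 2 = d1 + d2 + N)%N ->
  residue_sum p1 (U1 * 'X^M) + residue_sum (revp d2 p2) (U2 * 'X^M') =
  residue_sum (p1 * p2) (E * 'X^M).
Proof.
move=> D s1 s2 p20 hE h1 h2 eM.
have p1n0 : p1 != 0 by rewrite -size_poly_gt0 s1.
have p2n0 : p2 != 0 by rewrite -size_poly_gt0 s2.
set g := p1 * p2 in hE *; set q := revp d2 p2 in h2 *.
have gn0 : g != 0 by rewrite mulf_neq0.
have sg : size g = (d1 + d2).+1 by rewrite size_mul // s1 s2 addSn addnS.
have qd2 : q`_d2 = p2.[0] by rewrite coef_revp // subnn horner_coef0.
have sq : size q = d2.+1.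
  apply/eqP; rewrite eqn_leq size_revp /= ltnNge; apply/negP => sq.
  by move: p20; rewrite -qd2 nth_default ?eqxx.
have qn0 : q != 0 by rewrite -size_poly_gt0 sq.
have lq : lead_coef q = p2.[0] by rewrite lead_coefE sq.
have q0 : q`_0 = lead_coef p2 by rewrite coef_revp // subn0 lead_coefE s2.
set A1 := (U1 * 'X^M) %% p1; set R := (E * 'X^M) %% g.
have d1A1 : p1 %| U1 * 'X^M - A1.
  by rewrite /A1 {1}(divp_eq (U1 * 'X^M) p1) addrK dvdp_mulIr.
have dR : g %| E * 'X^M - R.
  by rewrite /R {1}(divp_eq (E * 'X^M) g) addrK dvdp_mulIr.
(* Modulo [p1], both [E] and [U1 * p2] invert [D]. The quotient [A2] gives
   [R / g = A1 / p1 + A2 / p2]. *)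
have /dvdpP[A2 eA2] : p1 %| R - A1 * p2.
  have -> : R - A1 * p2 = - (E * 'X^M - R) + (U1 * 'X^M - A1) * p2
      + E * 'X^M * (1 - U1 * (p2 * D)) - U1 * 'X^M * p2 * (1 - E * D) by ring.
  have p1g : p1 %| g := dvdp_mulIl _ _.
  rewrite dvdp_sub ?(dvdp_mull _ (dvdp_trans p1g hE)) //.
  rewrite dvdp_add ?(dvdp_mull _ h1) //.
  by rewrite dvdp_add ?(dvdp_mulr _ d1A1) // dvdpNr (dvdp_trans p1g).
have eR : R = A1 * p2 + A2 * p1 by rewrite -eA2; ring.
have sA1 : (size A1 <= d1)%N by rewrite -ltnS -s1 ltn_modp.
have sR : (size R <= d1 + d2)%N by rewrite -ltnS -sg ltn_modp.
have sA2 : (size A2 <= d2)%N.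
  apply: (size_factor_leq s1); rewrite -eA2 addnC.
  rewrite (leq_trans (size_polyD _ _)) // geq_max sR size_polyN /=.
  by rewrite size_polyM_leq ?s2.
(* Numerator over [D]: ['X^M / (g * D) = A1 / p1 + A2 / p2 + A3 / D]. *)
have /dvdpP[A3 eA3] : g %| 'X^M - R * D.
  have -> : 'X^M - R * D = 'X^M * (1 - E * D) + (E * 'X^M - R) * D by ring.
  by rewrite dvdp_add ?(dvdp_mull _ hE) ?(dvdp_mulr _ dR).
have sA3 : (size A3 <= N.+1)%N.
  apply: (size_factor_leq sg); rewrite -eA3 (leq_trans (size_polyD _ _)) //.
  rewrite geq_max size_polyXn size_polyN addSn addnC; apply/andP; split.
    by rewrite ltnS -eM -addnA leq_addr.
  by rewrite (leq_trans (size_polyM_leq sR (size_1subXn _ _))).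
have -> : residue_sum g (E * 'X^M) = residue_sum g R.
  exact: residue_sum_congr.
rewrite eR residue_sumD residue_sum_mul2r //.
have -> : residue_sum g (A2 * p1) = residue_sum p2 A2.
  by rewrite /g mulrC residue_sum_mul2r.
have -> : residue_sum p1 (U1 * 'X^M) = residue_sum p1 A1.
  exact: residue_sum_congr.
congr (_ + _).
pose T := (U2 * 'X^M') %% q.
have dT : q %| U2 * 'X^M' - T.
  by rewrite /T {1}(divp_eq (U2 * 'X^M') q) addrK dvdp_mulIr.
have -> : residue_sum q (U2 * 'X^M') = residue_sum q T.
  exact: residue_sum_congr.
pose A2r := revp d2 A2; have sA2r : (size A2r <= d2.+1)%N by apply: size_revp.
have sT : (size T <= d2)%N by rewrite -ltnS -sq ltn_modp.
(* The index [d2.-1] used below is truncated when [p2] is constant; then [T] and [A2] are both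
   zero. *)
have [d20|d2_gt0] := posnP d2.
  move: sT sA2; rewrite d20 !leqn0 !size_poly_eq0 => /eqP -> /eqP ->.
  by rewrite /residue_sum !mod0p !coef0 !mul0r.
(* Since [A2] has degree less than [d2], [S] is its reversal to degree [d2 - 1]. *)
have /dvdpP[S eS] : 'X %| A2r.
  by rewrite -['X]subr0 dvdp_XsubCl /root horner_coef0 coef_revp // subn0 nth_default.
have eR' : revp (d1 + d2) R = revp d1 A1 * q + A2r * revp d1 p1.
  by rewrite eR revpD revpM ?s2 // 1?leqW // [(d1 + d2)%N]addnC revpM ?s1 // leqW.
(* Reversal of ['X^M = R * D + g * A3] to degree [d1 + d2 + N]. *)
have eX : 'X^(M' + 2) = - (revp d1 A1 * q + A2r * revp d1 p1) * D
    + revp N A3 * (revp d1 p1 * q).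
  have -> : (M' + 2 = d1 + d2 + N - M)%N by rewrite -eM -addnA addKn.
  rewrite -revpXn; last by rewrite -eM -addnA leq_addr.
  have -> : 'X^M = R * D + g * A3 by rewrite [g * _]mulrC -eA3 addrC subrK.
  rewrite revpD !revpM ?size_1subXn ?sg ?s1 ?s2 // 1?leqW //.
  by rewrite eR' revp_1subXn -/D -/q; ring.
(* Multiplying [eX] by [U2] gives X^2 T = - X S modulo [q], and X can be cancelled because [q] does
   not vanish at 0. *)
have /dvdpP[k ek] : q %| 'X * T + S.
  have cq : coprimep q 'X.
    by rewrite coprimepX /root horner_coef0 q0 lead_coef_eq0.
  rewrite -(Gauss_dvdpr _ cq).
  have -> : 'X * ('X * T + S) = - ('X^2 * (U2 * 'X^M' - T))
      + A2r * (1 - U2 * (revp d1 p1 * D))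
      + q * (U2 * (revp N A3 * revp d1 p1 - revp d1 A1 * D)).
    rewrite eS; have := congr1 ( *%R U2) eX; rewrite eS exprD => eU.
    have -> : 'X^2 * (U2 * 'X^M' - T) = U2 * ('X^M' * 'X^2) - 'X^2 * T by ring.
    by rewrite eU; ring.
  by rewrite !dvdp_add ?dvdpNr ?(dvdp_mull _ h2) ?(dvdp_mull _ dT) ?dvdp_mulIl.
have sS : (size S <= d2)%N.
  have [->|S0] := eqVneq S 0; first by rewrite size_poly0.
  by move: sA2r; rewrite eS size_mulX.
(* Comparing coefficients of degrees [d2] and 0 in ['X * T + S = k * q], with [k] constant, shows
   that both residue sums equal this constant. *)
have sk : (size k <= 1)%N.
  apply: (size_factor_leq sq); rewrite -ek add1n (leq_trans (size_polyD _ _)) //.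
  rewrite geq_max [(size S <= _)%N]leqW // andbT.
  have [->|T0] := eqVneq T 0; first by rewrite mulr0 size_poly0.
  by rewrite mulrC size_mulX.
move: ek; rewrite (size1_polyC sk) => ek.
have := congr1 (fun P : {poly F} => P`_d2) ek.
rewrite coefD coefXM coefCM gtn_eqF // [S`__]nth_default // addr0 qd2 => eT.
have := congr1 (fun P : {poly F} => P`_0) ek.
rewrite coefD coefXM coefCM /= add0r q0 => eS0.
have {eS0} eA : A2`_d2.-1 = k`_0 * lead_coef p2.
  by rewrite -eS0 -subn1 -(coef_revp _ d2_gt0) -/A2r eS coefMX.
rewrite !residue_sum_small ?sq ?s2 ?ltnS //= lq eT eA !mulfK //.
by rewrite lead_coef_eq0.
Qed.

(* Both p1 and the reversal of q divide g, and they are coprime since their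
   roots lie inside and outside the unit circle; the remaining cofactor has no
   root at all. *)
Lemma revp_factorization (F : numClosedFieldType) (d : nat)
    (g p1 p2 q h2 : {poly F}) :
  size g = d.+1 -> g.[0] != 0 ->
  (forall x, `|x| = 1 -> g.[x] != 0) ->
  g = p1 * p2 -> revp d g = q * h2 ->
  (forall x, root p1 x -> `|x| < 1) -> (forall x, `|x| < 1 -> p2.[x] != 0) ->
  (forall x, root q x -> `|x| < 1) -> (forall x, `|x| < 1 -> h2.[x] != 0) ->
  exists (c : F) (d1 d2 : nat),
    [/\ c != 0, size p1 = d1.+1, size p2 = d2.+1 & (d1 + d2)%N = d] /\
    revp d2 p2 = c *: q /\ h2 = c *: revp d1 p1.
Proof.
move=> sg g0 gU eg eh p1in p2in qin h2in.
have gn0 : g != 0 by rewrite -size_poly_gt0 sg.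
have p1n0 : p1 != 0 by apply: contraNneq gn0 => e; rewrite eg e mul0r.
have p2n0 : p2 != 0 by apply: contraNneq gn0 => e; rewrite eg e mulr0.
have sh : size (revp d g) = d.+1.
  apply/eqP; rewrite eqn_leq size_revp /= ltnNge; apply/negP => le_d.
  move: g0; rewrite horner_coef0 -(subnn d) -coef_revp // nth_default ?eqxx //.
have hn0 : revp d g != 0 by rewrite -size_poly_gt0 sh.
have qn0 : q != 0 by apply: contraNneq hn0 => e; rewrite eh e mul0r.
have h2n0 : h2 != 0 by apply: contraNneq hn0 => e; rewrite eh e mulr0.
case s1 : (size p1) => [|d1]; first by move/eqP: s1; rewrite size_poly_eq0 (negPf p1n0).
case s2 : (size p2) => [|d2]; first by move/eqP: s2; rewrite size_poly_eq0 (negPf p2n0).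
case sq : (size q) => [|e2]; first by move/eqP: sq; rewrite size_poly_eq0 (negPf qn0).
case sh2 : (size h2) => [|e1]; first by move/eqP: sh2; rewrite size_poly_eq0 (negPf h2n0).
have ed : (d1 + d2)%N = d by move: sg; rewrite eg size_mul // s1 s2 addSn addnS => -[].
have ee : (e2 + e1)%N = d by move: sh; rewrite eh size_mul // sq sh2 addSn addnS => -[].
have eg' : g = revp e2 q * revp e1 h2.
  by rewrite -revpM ?sq ?sh2 // ee -eh revpK // sg.
have root_neq0 x : root g x -> x != 0.
  by apply: contraTneq => ->; rewrite /root.
have inv_gt1 (x : F) : x != 0 -> `|x| < 1 -> 1 < `|x^-1|.
  by move=> x0 x1; rewrite normfV invf_gt1 ?normr_gt0.
have inv_lt1 (x : F) : x != 0 -> 1 < `|x| -> `|x^-1| < 1.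
  by move=> x0 x1; rewrite normfV invf_lt1 ?normr_gt0.
have cop : coprimep p1 (revp e2 q).
  apply/Pdiv.ClosedField.coprimepP => x p1x.
  have x0 : x != 0 by apply: root_neq0; rewrite eg rootM p1x.
  rewrite horner_revp ?sq // mulf_neq0 ?expf_neq0 //; apply/negP => /qin.
  by have := inv_gt1 _ x0 (p1in _ p1x) => /ltW/le_lt_trans h /h; rewrite ltxx.
have /dvdpP[c ec] : p1 %| revp e1 h2.
  by rewrite -(Gauss_dvdpr _ cop) -eg' eg dvdp_mulIl.
have ep2 : p2 = c * revp e2 q.
  apply: (mulfI p1n0); rewrite -eg eg' ec; ring.
(* A root [x] of [c] is excluded inside the circle by [p2], outside by [h2] at [x^-1], and on the
   circle by [g]. *)
have /size_poly1P[c' c'0 ec'] : size c == 1.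
  apply/negPn/negP => /closed_rootP[x cx].
  have gx : root g x by rewrite eg ep2 !rootM cx orbT.
  have x0 := root_neq0 _ gx.
  case: (real_ltgtP (normr_real x) (real1 F)) => x1.
  - by move: (p2in _ x1); rewrite ep2 hornerM (rootP cx) mul0r eqxx.
  - have : root (revp e1 h2) x by rewrite ec rootM cx.
    rewrite /root horner_revp ?sh2 // mulf_eq0 expf_eq0 (negPf x0) andbF /=.
    by rewrite (negPf (h2in _ (inv_lt1 _ x0 x1))).
  - by move: (gU _ x1); rewrite (rootP gx) eqxx.
(* The constant term of [revp d g] is the leading coefficient of [g]. Hence reversing [q] keeps its
   size, which identifies [e2] with [d2]. *)
have q0 : q`_0 != 0.
  have : (revp d g)`_0 != 0.
    by rewrite coef_revp // subn0 -[d]/(d.+1.-1) -sg -lead_coefE lead_coef_eq0.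
  by rewrite eh coef0M mulf_eq0 negb_or => /andP[].
have ed2 : e2 = d2.
  have sr : size (revp e2 q) = d2.+1 by rewrite -s2 ep2 ec' mul_polyC size_scale.
  apply/eqP; rewrite eqn_leq -[(d2 <= _)%N]ltnS -sr size_revp andbT leqNgt.
  apply: contraNN q0 => lt_de.
  by rewrite -[0%N](subnn e2) -coef_revp // nth_default ?sr.
have er : revp d2 p2 = c' *: q.
  by rewrite ep2 ec' mul_polyC revpZ -ed2 revpK ?sq.
exists c', d1, d2; split=> //; split=> //.
apply: (mulfI qn0); rewrite -eh eg -ed revpM ?s1 ?s2 // er.
by rewrite -!scalerAr mulrC.
Qed.

(** * Derivatives of inverses of polynomials *)

Lemma is_derive_horner (K : numFieldType) (p : {poly K}) (x : K) :
  is_derive x 1 (horner p : K -> K^o) p^`().[x].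
Proof.
elim/poly_ind: p => [|p c IH].
  have -> : horner (0 : {poly K}) = cst 0 by apply/funext => y; rewrite horner0.
  by rewrite deriv0 horner0; exact: is_derive_cst.
have -> : horner (p * 'X + c%:P) = (horner p : K -> K^o) * id + cst c.
  by apply/funext => y; rewrite !hornerE.
apply: is_derive_eq.
rewrite derivD derivC addr0 derivM derivX !hornerE /GRing.scale /= /cst /=; ring.
Qed.

Lemma near_horner_neq0 (K : numFieldType) (p : {poly K}) (x : K) :
  p.[x] != 0 -> (\near x, p.[x] != 0).
Proof.
move=> px0; have cp : {for x, continuous (horner p : K -> K^o)}.
  by apply/differentiable_continuous/derivable1_diffP; have [] := is_derive_horner p x.
apply: (cp [set y | y != 0]%classic).
exists `|p.[x]|; first by rewrite /= normr_gt0.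
by move=> y /=; apply: contraTneq => ->; rewrite subr0 ltxx.
Qed.

(* A rational function that vanishes at w to an order larger than j does not
   contribute to the j-th derivative at w, so 1 / f may be replaced with a
   polynomial inverse of f modulo a power of X - w. *)
Lemma derive1n_rational_near (K : numFieldType) (f : {poly K}) (w : K) (j : nat) :
  f.[w] != 0 ->
  forall (k : nat) (P Q : {poly K}) (F : K -> K^o),
  ('X - w%:P) ^+ j.+1 %| Q ->
  (\near w, F w = P.[w] + Q.[w] / f.[w] ^+ k) ->
  derive1n j F w = (derivn j P).[w].
Proof.
move=> fw0; elim: j => [|j IH] k P Q F dQ nF.
  rewrite /derive1n /= (nbhs_singleton nF).
  have /dvdpP[q ->] := dQ.
  by rewrite !hornerE subrr !mulr0 !mul0r addr0.
have fw := near_horner_neq0 fw0.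
(* Quotient rule: [Q'] is the numerator of the derivative of [Q / f ^+ k] over [f ^+ k.+1]. Its
   order of vanishing at [w] drops by at most one. *)
rewrite /derive1n iterSr derivSn; pose Q' := Q^`() * f - k%:R *: (Q * f^`()).
apply: (IH k.+1 P^`() Q').
  have /dvdpP[q Qq] := dQ.
  rewrite /Q' {}Qq derivM deriv_exp /= derivXsubC mul1r.
  rewrite -[_ *+ j.+2]mulr_natl -!mul_polyC /=.
  set Y := 'X - w%:P.
  apply/dvdpP; exists ((q^`() * Y + q * (j.+2)%:R) * f - k%:R%:P * (q * Y * f^`())).
  rewrite !exprS; move: (q^`()) (f^`()) _%:P j.+2%:R (Y ^+ j) => a b c d e.
  ring.
(* The derivative of [F] at a point [x] near [w] involves the values of [F] around [x]. *)
move/near_join: nF; move/near_join: fw => fw nF; near=> x.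
have /nbhs_singleton fx : \near x, f.[x] != 0 by near: x.
have Fx : \near x, F x = P.[x] + Q.[x] / f.[x] ^+ k by near: x.
have Df := is_derive_horner f x.
have Dg : is_derive x 1 (fun y : K => (f.[y] ^+ k)^-1 : K^o)
    (- (f.[x] ^+ k) ^- 2 *: ((k%:R * f.[x] ^+ k.-1) *: f^`().[x])).
  have [df1 df2] := @is_deriveX _ _ _ k _ _ _ Df.
  have fk0 : (horner f ^+ k) x != 0 by rewrite exprfctE expf_neq0.
  split; first by have := derivableV fk0 df1; rewrite exprfctE.
  by have := deriveV fk0 df1; rewrite df2 exprfctE.
have DP := is_derive_horner P x.
have DQ := is_derive_horner Q x.
have PQF : \near x, (horner P + horner Q * (fun y => (f.[y] ^+ k)^-1)) x = F x.
  by apply: filterS Fx => y ->.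
have [_] := near_eq_is_derive PQF (is_deriveD DP (is_deriveM DQ Dg)).
rewrite derive1E => ->; rewrite /Q' /GRing.scale /= !hornerE /=.
clear - fx; case: k => [|k] /=; first by rewrite !expr0; field.
by rewrite !exprS; field; rewrite fx expf_neq0.
Unshelve. all: by end_near. Qed.

Lemma horner_1subXn (K : nzRingType) (N : nat) (x : K) :
  (1 - 'X^N : {poly K}).[x] = 1 - x ^+ N.
Proof. by rewrite hornerD hornerN hornerXn hornerC. Qed.

Lemma horner_1subXn_neq0 (K : numDomainType) (N : nat) (x : K) :
  (0 < N)%N -> `|x| != 1 -> (1 - 'X^N : {poly K}).[x] != 0.
Proof.
move=> N0; apply: contraNN; rewrite horner_1subXn subr_eq0 => /eqP e.
by rewrite -(@pexpr_eq1 _ _ N) // -normrX -e normr1.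
Qed.

(** Write [1 / f = u + (1 - u * f) / f]: the last term vanishes at [w] to order at least [r > j]. *)
Lemma derive1n_inv_horner (K : numFieldType) (f u : {poly K}) (w : K) (r j : nat) :
  (j < r)%N -> ('X - w%:P) ^+ r %| 1 - u * f ->
  derive1n j (fun x => (f.[x])^-1 : K^o) w = (u \Po ('X + w%:P))`_j *+ j`!.
Proof.
move=> jr ruf.
have fw0 : f.[w] != 0.
  have : 'X - w%:P %| 1 - u * f.
    by apply: dvdp_trans ruf; rewrite -[X in X %| _]expr1 dvdp_exp2l // (leq_trans _ jr).
  rewrite dvdp_XsubCl /root !hornerE; apply: contraTneq => ->.
  by rewrite mulr0 subr0 oner_eq0.
rewrite coef_comp_XaddC; apply: (derive1n_rational_near fw0 (k := 1) (Q := 1 - u * f)).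
  by apply: dvdp_trans ruf; rewrite dvdp_exp2l.
apply: filterS (near_horner_neq0 fw0) => x fx.
by rewrite !hornerE; field.
Qed.

(** * The inner sums of $b_j$ as residues at a single pole *)

Lemma coef_Xn_comp_XaddC (K : numFieldType) (w : K) (M i : nat) :
  ('X^M \Po ('X + w%:P))`_i * (i`!)%:R = (M ^_ i)%:R * w ^ (M%:Z - i%:Z).
Proof.
rewrite mulr_natr coef_comp_XaddC derivnXn hornerMn hornerXn mulr_natl.
case: (leqP i M) => iM; first by rewrite subzn.
by rewrite ffact_small ?mulr0n.
Qed.

Lemma fact_bin_simplify (F : numFieldType) (r i j : nat) (a b : F) :
  (j + i <= r)%N ->
  (r`!)%:R^-1 * 'C(r, j + i)%:R * 'C(j + i, i)%:R * (a *+ (r - (j + i))`!)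
    * (b *+ j`!) = a * b / (i`!)%:R.
Proof.
move=> jr; have f0 k : (k`!)%:R != 0 :> F by rewrite pnatr_eq0 -lt0n fact_gt0.
have e1 := congr1 (fun k => k%:R : F) (bin_fact jr).
have e2 := congr1 (fun k => k%:R : F) (bin_fact (leq_addl j i)).
rewrite -mulr_natr -[b *+ _]mulr_natr -e1 !natrM -e2 addnK !natrM.
have b1 : 'C(r, j + i)%:R != 0 :> F by rewrite pnatr_eq0 -lt0n bin_gt0.
have b2 : 'C(j + i, i)%:R != 0 :> F by rewrite pnatr_eq0 -lt0n bin_gt0 leq_addl.
by field; rewrite b1 b2 !f0.
Qed.

(** This is the Leibniz rule: the derivatives are Taylor coefficients of [u] and [v] times
    factorials, which cancel the binomials up to [1 / i!], leaving a convolution. *)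
Lemma ccoefE (R : realType) (N : nat) (f u v : {poly R[i]}) (w : R[i]) (r i : nat) :
  (i <= r)%N ->
  ('X - w%:P) ^+ r.+1 %| 1 - u * deflate f w r.+1 ->
  ('X - w%:P) ^+ r.+1 %| 1 - v * (1 - 'X^N) ->
  ccoef N f w r.+1 i = ((u * v) \Po ('X + w%:P))`_(r - i) / (i`!)%:R.
Proof.
move=> ir hu hv; rewrite /ccoef subn1 /= rmorphM /= coefMr.
rewrite -[X in index_iota X _]add0n big_addn big_mkord mulr_suml subSn //.
apply: eq_bigr => j _.
have jr : (j + i <= r)%N by rewrite addnC -leq_subRL // -ltnS.
have -> : (fun x : R[i] => (1 - x ^+ N)^-1 : R[i]^o) =
    (fun x : R[i] => ((1 - 'X^N : {poly R[i]}).[x])^-1 : R[i]^o).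
  by apply/funext => x; rewrite horner_1subXn.
have jr1 : (r - (j + i) < r.+1)%N by rewrite ltnS leq_subr.
have jr2 : (j < r.+1)%N by rewrite ltnS (leq_trans (leq_addr _ _) jr).
have E1 := derive1n_inv_horner jr1 hu.
have E2 := derive1n_inv_horner jr2 hv.
rewrite addnK [in LHS]E2 [in LHS]E1 {E1 E2}.
have -> : (r - i - j)%N = (r - (j + i))%N by rewrite addnC subnDA.
exact: fact_bin_simplify.
Qed.

(** A second convolution, with the Taylor coefficients of ['X^M] at [w], whose derivatives absorb
    the remaining [1 / i!]. *)
Lemma sum_ccoef_local (R : realType) (N M : nat) (f u v : {poly R[i]}) (w : R[i]) (r : nat) :
  ('X - w%:P) ^+ r %| 1 - u * deflate f w r ->
  ('X - w%:P) ^+ r %| 1 - v * (1 - 'X^N) ->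
  \sum_(i < r) ccoef N f w r i * (M ^_ i)%:R * w ^ (M%:Z - i%:Z) =
  residue_sum (('X - w%:P) ^+ r) (u * v * 'X^M).
Proof.
case: r => [|r] hu hv.
  by rewrite big_ord0 /residue_sum expr0 modp1 coef0 mul0r.
rewrite residue_sum_XsubC_exp rmorphM /= coefMr.
apply: eq_bigr => i _; rewrite (@ccoefE R N f u v w r i) ?leq_ord //.
by rewrite -mulrA -coef_Xn_comp_XaddC [_`_i * _]mulrC -mulrA mulKf.
Qed.

(** * Circulant matrices *)

Lemma modn_addB (N x y : nat) : (x < N)%N -> (y < N)%N ->
  ((x + N - y) %% N)%N = if (y <= x)%N then (x - y)%N else (x + N - y)%N.
Proof.
move=> xN yN; case: leqP => xy; last by rewrite modn_small //; lia.
by rewrite -addnBAC // modnDr modn_small //; lia.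
Qed.

Lemma modn_addB_eq0 (N x y : nat) : (x < N)%N -> (y < N)%N ->
  ((x + N - y) %% N == 0)%N = (x == y).
Proof. by move=> xN yN; rewrite modn_addB //; case: ifP; lia. Qed.

(** The sum is an entry of the product matrix with [t] the row index minus the column index modulo
    [N]; [k] is shifted by [n] as in [gpoly]. *)
Lemma sum_band_residue_sum (F : fieldType) (a : int -> F) (m n N t : nat)
    (E : {poly F}) (b : nat -> F) :
  let g := \sum_(i < m + n) a (i%:Z - n%:Z) *: 'X^i in
  (2 <= m)%N -> (m + n <= N)%N -> a (m%:Z - 1) != 0 ->
  g %| 1 - E * (1 - 'X^N) ->
  (forall l, (l < N)%N -> b l = residue_sum g (E * 'X^(N + n - 1 - l))) ->
  (t < N)%N ->
  \sum_(k < m + n) a (k%:Z - n%:Z)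
     * b ((t + N - (if (k < n)%N then k + (N - n) else k - n)) %% N)%N = (t == 0)%N%:R.
Proof.
move=> g hm hN am gE bE tN.
have gP : g = \poly_(i < m + n) a (i%:Z - n%:Z).
  by rewrite poly_def.
have lg : a ((m + n).-1%:Z - n%:Z) = a (m%:Z - 1) by congr a; lia.
have sg : size g = (m + n)%N by rewrite gP size_poly_eq // lg.
have lcg : lead_coef g = a (m%:Z - 1).
  by rewrite lead_coefE sg gP coef_poly ifT ?lg //; lia.
pose phi P := residue_sum g (E * P).
(* ['X^N] is [1 - D], and [E * D] is 1 modulo [g]. *)
have phiD e : phi ('X^(N + e)) = phi ('X^e) - residue_sum g 'X^e.
  apply/eqP; rewrite eq_sym subr_eq -residue_sumD; apply/eqP.
  apply: residue_sum_congr.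
  have -> : E * 'X^e - (E * 'X^(N + e) + 'X^e) = - ('X^e * (1 - E * (1 - 'X^N))).
    by rewrite exprD; ring.
  by rewrite dvdpNr dvdp_mull.
have res e : (e <= m + n - 2)%N ->
    residue_sum g 'X^e = (e == m + n - 2)%N%:R / a (m%:Z - 1).
  move=> he; rewrite residue_sum_small ?size_polyXn ?sg ?lcg; last by lia.
  by rewrite coefXn -subn2 eq_sym.
(* In the first and last of the four cases below, the exponent differs from [N - 1 - t + k] by [N].
   The first correction has degree at most [n - 1 < m + n - 2] and vanishes; the last one survives
   only for [t = 0] and the largest [k]. *)
transitivity (\sum_(k < m + n) a (k%:Z - n%:Z) *
    (phi 'X^(N - 1 - t + k) + ((t == 0)%N && (k == (m + n).-1 :> nat))%:R / a (m%:Z - 1))).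
  apply: eq_bigr => k _; congr (_ * _); have km := ltn_ord k.
  case: ifP => kn; rewrite modn_addB //; try lia; case: ifP => kt; rewrite bE; try lia.
  - have -> : (N + n - 1 - (t - (k + (N - n))) = N + (N - 1 - t + k))%N by lia.
    rewrite -/(phi _) phiD res; last by lia.
    have -> : (t == 0)%N = false by lia.
    have -> : (N - 1 - t + k == m + n - 2)%N = false by lia.
    by rewrite !mul0r subr0 addr0.
  - have -> : (N + n - 1 - (t + N - (k + (N - n))) = N - 1 - t + k)%N by lia.
    have -> : ((t == 0)%N && (k == (m + n).-1 :> nat)) = false by lia.
    by rewrite mul0r addr0.
  - have -> : (N + n - 1 - (t - (k - n)) = N - 1 - t + k)%N by lia.
    have -> : ((t == 0)%N && (k == (m + n).-1 :> nat)) = false by lia.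
    by rewrite mul0r addr0.
  - have -> : (N + n - 1 - (t + N - (k - n)) = k - 1 - t)%N by lia.
    have -> : (N - 1 - t + k = N + (k - 1 - t))%N by lia.
    rewrite -/(phi _) phiD res; last by lia.
    have -> : ((t == 0)%N && (k == (m + n).-1 :> nat)) = (k - 1 - t == m + n - 2)%N by lia.
    by rewrite subrK.
under eq_bigr do rewrite mulrDr.
rewrite big_split /= [X in X + _](_ : _ = 0) ?add0r; last first.
  transitivity (phi ('X^(N - 1 - t) * g)).
    rewrite /phi gP poly_def !mulr_sumr residue_sum_sum; apply: eq_bigr => k _.
    by rewrite -residue_sumZ exprD -!scalerAr.
  rewrite /phi mulrA; have -> : residue_sum g (E * 'X^(N - 1 - t) * g) = residue_sum g 0.
    by apply: residue_sum_congr; rewrite subr0 dvdp_mull.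
  by rewrite /residue_sum mod0p coef0 mul0r.
have mn : ((m + n).-1 < m + n)%N by lia.
rewrite (bigD1 (Ordinal mn)) //= big1 ?addr0 => [|k km].
  by rewrite eqxx andbT lg mulrCA divff ?mulr1.
have /negPf -> : (k : nat) != (m + n).-1.
  by apply: contraNneq km => ek; apply/eqP/val_inj.
by rewrite andbF mul0r mulr0.
Qed.

(** Replacing the summation index [k] by [i - k] modulo [N] is an involution that turns the entry of
    the first factor into [c k]. *)
Lemma circulant_mul (R : realType) (N : nat) (c b : nat -> R[i]) :
  circulant N c *m circulant N b =
  circulant N (fun t => \sum_(k < N) c k * b ((t + N - k) %% N)%N).
Proof.
apply/matrixP => i j; rewrite !mxE.
have N0 : (0 < N)%N by case: N i {j} => [[]|].
pose h (k : 'I_N) := Ordinal (ltn_pmod (i + N - k) N0).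
have hK : involutive h.
  move=> k; apply: val_inj => /=; rewrite (modn_addB (ltn_ord i) (ltn_ord k)).
  have kN := ltn_ord k; have iN := ltn_ord i.
  by case: ifP => ki; rewrite modn_addB; try lia; case: ifP => ?; lia.
rewrite (reindex_inj (inv_inj hK)); apply: eq_bigr => k _.
rewrite !mxE; have -> : ((i + N - h k) %% N = k)%N := congr1 val (hK k).
congr (_ * b _) => /=.
have kN := ltn_ord k; have iN := ltn_ord i; have jN := ltn_ord j.
rewrite !(modn_addB (ltn_ord i)) //.
by do 2!case: ifP => ?; rewrite !modn_addB; try lia; do ?case: ifP => ?; lia.
Qed.

(** Of the blocks [[0, m)], [[m, N - n)] and [[N - n, N)], the middle one is zero and the last one,
    carrying the negative indices, is moved to the front. *)
Lemma sum_banded_col (R : realType) (a : int -> R[i]) (m n N : nat) (f : nat -> R[i]) :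
  (m + n <= N)%N ->
  \sum_(k < N) banded_col a m n N k * f k =
  \sum_(i < m + n) a (i%:Z - n%:Z) * f (if (i < n)%N then i + (N - n) else i - n)%N.
Proof.
move=> hN; pose F k := banded_col a m n N k * f k.
pose G i := a (i%:Z - n%:Z) * f (if (i < n)%N then i + (N - n) else i - n)%N.
rewrite -(big_mkord xpredT F) -(big_mkord xpredT G).
have mN : (m <= N)%N by lia.
have mNn : (m <= N - n)%N by lia.
rewrite (big_cat_nat (leq0n m) mN) (big_cat_nat mNn (leq_subr n N)).
rewrite [RHS](big_cat_nat (leq0n n) (leq_addl m n)) /= [LHS]addrC; congr (_ + _); last first.
  have := big_addn 0 (m + n) n xpredT G; rewrite add0n addnK => ->.
  apply: eq_big_nat => k /andP[_ km].
  rewrite /F /G /banded_col km addnK ltnNge leq_addl /=.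
  by congr (a _ * _); lia.
rewrite big_nat_cond big1 ?add0r => [|k /andP[/andP[mk kN] _]]; last first.
  by rewrite /F /banded_col ltnNge mk leqNgt kN mul0r.
have := big_addn 0 N (N - n) xpredT F; rewrite add0n subKn => [->|]; last by lia.
apply: eq_big_nat => k /andP[_ kn].
rewrite /F /G /banded_col kn leq_addl ifF; last by lia.
by congr (a _ * _); lia.
Qed.

(** * Residue form of $b_j$ and inversion of $A$ *)

Lemma sum_ccoef (R : realType) (N M s : nat) (z : 'I_s -> R[i])
    (p : 'I_s -> nat) (f2 U : {poly R[i]}) :
  let p1 := \prod_k ('X - (z k)%:P) ^+ p k in
  injective z -> p1 %| 1 - U * (f2 * (1 - 'X^N)) ->
  \sum_(k < s) \sum_(i < p k)
     ccoef N (p1 * f2) (z k) (p k) i * (M ^_ i)%:R * z k ^ (M%:Z - i%:Z) =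
  residue_sum p1 (U * 'X^M).
Proof.
move=> p1 z_inj; set D := 1 - 'X^N => hU.
pose Y k := ('X - (z k)%:P) ^+ p k.
have Y0 k : Y k != 0 by rewrite expf_neq0 // polyXsubC_eq0.
have cY i j : i != j -> coprimep (Y i) (Y j).
  by move=> ij; rewrite coprimep_XsubC_exp // (inj_eq z_inj).
have [e he ->] := residue_sum_prod (U * 'X^M) Y0 cY.
apply: eq_bigr => k _; pose L := \prod_(j | j != k) Y j.
have eY : p1 = Y k * L by rewrite /p1 (bigD1 k).
have hUk : Y k %| 1 - U * (f2 * D).
  by apply: dvdp_trans hU; rewrite eY dvdp_mulIl.
have ed : deflate (p1 * f2) (z k) (p k) = L * f2.
  by rewrite /deflate eY -mulrA mulKp.
(* Modulo [Y k], [U * D * e k] inverts the deflated polynomial [L * f2], [U * f2] inverts [D], and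
   their product reduces to [U * e k]. *)
rewrite (@sum_ccoef_local R N M (p1 * f2) (U * D * e k) (U * f2)).
- apply: residue_sum_congr.
  have -> : U * D * e k * (U * f2) * 'X^M - U * 'X^M * e k =
    - (U * e k * 'X^M * (1 - U * (f2 * D))) by ring.
  by rewrite dvdpNr dvdp_mull.
- rewrite ed.
  have -> : 1 - U * D * e k * (L * f2) =
    (1 - U * (f2 * D)) + U * (f2 * D) * (1 - e k * L) by ring.
  by rewrite dvdp_add ?dvdp_mull // he.
- by rewrite -mulrA.
Qed.

Lemma hpolyE (R : realType) (a : int -> R[i]) (m n : nat) :
  hpoly a m n = revp (m + n - 1) (gpoly a m n).
Proof.
rewrite /hpoly /gpoly revp_sum; apply: eq_bigr => i _.
by rewrite revpZ revpXn //; have := ltn_ord i; lia.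
Qed.

Theorem theorem2p1 (R : realType) (m n N : nat) (a : int -> R[i])
  (hm : (2 <= m)%N) (hN : (m + n <= N)%N)
  (ham : a (m%:Z - 1) != 0) (han : a (- n%:Z) != 0)
  (hU : forall u : R[i], `|u| = 1 -> ~~ root (gpoly a m n) u)
  (s : nat) (z : 'I_s -> R[i]) (p : 'I_s -> nat)
  (z_inj : injective z)
  (zP : forall u : R[i],
     (exists k, z k = u) <-> (root (gpoly a m n) u /\ `|u| < 1))
  (pE : forall k, p k = mup (z k) (gpoly a m n))
  (t : nat) (w : 'I_t -> R[i]) (q : 'I_t -> nat)
  (w_inj : injective w)
  (wP : forall u : R[i],
     (exists k, w k = u) <-> (root (hpoly a m n) u /\ `|u| < 1))
  (qE : forall k, q k = mup (w k) (hpoly a m n)) :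
  let A := circulant N (banded_col a m n N) in
  let B := circulant N
             (bcoef m n N (gpoly a m n) (hpoly a m n) z p w q) in
  A \in unitmx /\ invmx A = B.
Proof.
move=> A B.
suff AB : A *m B = 1%:M.
  have [uA _] := mulmx1_unit AB; split=> //.
  by rewrite -[RHS](mulKmx uA) AB mulmx1.
have N0 : (0 < N)%N by lia.
set g := gpoly a m n in hU zP pE A B *.
pose d := (m + n - 1)%N.
have gP : g = \poly_(i < m + n) a (i%:Z - n%:Z) by rewrite poly_def.
have sg : size g = d.+1.
  have -> : d.+1 = (m + n)%N by rewrite /d; lia.
  rewrite gP size_poly_eq //.
  have -> : (m + n).-1%:Z - n%:Z = m%:Z - 1 by lia.
  by [].
have g0 : g.[0] != 0.
  by rewrite horner_coef0 gP coef_poly ifT ?sub0r //; lia.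
have gU (x : R[i]) : `|x| = 1 -> g.[x] != 0 by move=> /hU.
have gn0 : g != 0 by rewrite -size_poly_gt0 sg.
have eh : hpoly a m n = revp d g by apply: hpolyE.
set h := hpoly a m n in wP qE B eh *.
have hn0 : h != 0.
  apply: contraNneq g0 => h0; rewrite horner_coef0 -(subnn d) -coef_revp //.
  by rewrite -eh h0 coef0.
have [p2 eg p2z] := prod_XsubC_exp_mup gn0 z_inj pE.
have [h2 ehq h2w] := prod_XsubC_exp_mup hn0 w_inj qE.
set p1 := \prod_k _ in eg; set r := \prod_k _ in ehq.
have p1in (x : R[i]) : root p1 x -> `|x| < 1.
  apply: (root_prod_XsubC_exp (Q := fun x => is_true (`|x| < 1))) => k.
  by have [_ +] := (zP (z k)).1 (ex_intro _ k erefl).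
have rin (x : R[i]) : root r x -> `|x| < 1.
  apply: (root_prod_XsubC_exp (Q := fun x => is_true (`|x| < 1))) => k.
  by have [_ +] := (wP (w k)).1 (ex_intro _ k erefl).
have p2in (x : R[i]) : `|x| < 1 -> p2.[x] != 0.
  move=> x1; have [gx|] := boolP (root g x).
    by have [k <-] := (zP x).2 (conj gx x1); apply: p2z.
  by rewrite eg rootM negb_or => /andP[].
have h2in (x : R[i]) : `|x| < 1 -> h2.[x] != 0.
  move=> x1; have [hx|] := boolP (root h x).
    by have [k <-] := (wP x).2 (conj hx x1); apply: h2w.
  by rewrite ehq rootM negb_or => /andP[].
have ehr : revp d g = r * h2 by rewrite -eh.
have [c [d1 [d2 [[c0 s1 s2 ed] [er eh2]]]]] :=
  revp_factorization sg g0 gU eg ehr p1in p2in rin h2in.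
pose D : {poly R[i]} := 1 - 'X^N.
have D0 (x : R[i]) : `|x| != 1 -> D.[x] != 0 by apply: horner_1subXn_neq0.
(* The inverses exist because the roots of [p1] and [r] lie inside the circle, where [p2], [h2] and
   [D] have none, and [g] and [D] share no root. *)
have [U1 hU1] : exists U, p1 %| 1 - U * (p2 * D).
  apply/coprimep_inverse/Pdiv.ClosedField.coprimepP => x /p1in x1.
  by rewrite hornerM mulf_neq0 ?p2in // D0 // lt_eqF.
have [U2 hU2] : exists U, r %| 1 - U * (h2 * D).
  apply/coprimep_inverse/Pdiv.ClosedField.coprimepP => x /rin x1.
  by rewrite hornerM mulf_neq0 ?h2in // D0 // lt_eqF.
have [E hE] : exists E, g %| 1 - E * D.
  apply/coprimep_inverse/Pdiv.ClosedField.coprimepP => x gx.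
  by apply: D0; apply: contraL gx => /eqP; apply: hU.
apply/matrixP => i j; rewrite /A /B circulant_mul !mxE.
rewrite (sum_banded_col a (fun k => _ ((_ + N - k) %% N)%N) hN).
set l := ((i + N - j) %% N)%N.
have lN : (l < N)%N by rewrite ltn_pmod.
have -> : (i == j) = (l == 0)%N by rewrite /l modn_addB_eq0.
apply: (sum_band_residue_sum (E := E)) => // k kN.
rewrite /bcoef eg ehq.
rewrite (sum_ccoef _ z_inj hU1) (sum_ccoef _ w_inj hU2).
(* Scaling by [c] turns [r] into the reversal of [p2], and [U2] into an inverse of [revp d1 p1 * D]
   modulo it. *)
rewrite -(@residue_sumZl _ r _ c) // -er scalerAl.
rewrite -[X in _ = residue_sum X _]/g eg.
apply: (residue_sum_reverse (d1 := d1) (N := N)) => //.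
- by rewrite p2in // normr0 ltr01.
- by rewrite -eg.
- by rewrite er dvdpZl // -scalerAl scalerAr scalerAl -eh2.
- by rewrite ed /d; clear -kN hm; lia.
Qed.
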